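(* Let $q,N,H,Q\in\mathbb{N}$ be such that $Q\ll N$, $H=o(q)$ and $q=o(N)$. For every sieve function $f:\mathbb{N}\to\mathbb{R}$ of range $Q$ and all $r,b\in\mathbb{Z}$ such that $\gcd(r,q)=1$, one has, for every $\varepsilon>0$, $$ \sum_{1\le a\le H}\ \sum_{\substack{N<n\le 2N\\ n\equiv ar+b\ (\mathrm{mod}\ q)}} f(n)\;-\;\frac{H}{q}\sum_{N<n\le 2N} f(n)\ \ll_{\varepsilon}\ N^{\varepsilon}\left(\frac{N}{q}+q+Q\right). $$
   Context: Sieve functions: an arithmetic function $f:\mathbb{N}\to\mathbb{R}$ is called a sieve function of range $Q$ (with $Q\in\mathbb{N}$) if its Eratosthenes transform $g=f\ast\mu$ (Dirichlet convolution with the Möbius function) vanishes outside $[1,Q]$ and is essentially bounded, i.e. $g(d)\ll_{\varepsilon} d^{\varepsilon}$ for all $\varepsilon>0$. Equivalently, $f(n)=\sum_{d\mid n,\ d\le Q} g(d)$ with such a $g$. Asymptotic conventions: the parameters $q,H,Q$ (and $f$) may vary with $N$; $H=o(q)$ is understood as $q\to\infty$, and $q=o(N)$ as $N\to\infty$. $A\ll_{\varepsilon}B$ is Vinogradov's notation, meaning $|A|\le C B$, where here $C$ depends only on $\varepsilon$ and on the implied constants in the hypotheses (those in $g(d)\ll_{\varepsilon'} d^{\varepsilon'}$, for $\varepsilon'>0$, and in $Q\ll N$); in particular the bound is uniform in $r$ and $b$. *)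

(* Defs.v *)
From mathcomp Require Import all_boot all_order all_algebra.
From mathcomp Require Import all_classical all_reals all_analysis.

Set Implicit Arguments.
Unset Strict Implicit.
Unset Printing Implicit Defensive.

Import Order.TTheory GRing.Theory Num.Theory.
Import numFieldNormedType.Exports.

Local Open Scope classical_set_scope.
Local Open Scope ring_scope.

(* Arithmetic functions are total on nat; only their values at positive
   arguments matter (divisors 0 is empty). *)

Definition mobius (R : realType) (n : nat) : R :=
  if all (fun p => logn p n == 1)%N (primes n) then (-1) ^+ size (primes n)
  else 0.

Definition dirichlet_conv (R : realType) (f g : nat -> R) (n : nat) : R :=
  \sum_(d <- divisors n) f d * g (n %/ d)%N.

Definition eratosthenes (R : realType) (f : nat -> R) : nat -> R :=
  dirichlet_conv f (@mobius R).

(* [K eps] is the implied constant in g(d) <<_eps d ^ eps.  It is a parameter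
   because estimates uniform over sieve functions may depend on it. *)
Definition essentially_bounded (R : realType) (K : R -> R) (g : nat -> R) :=
  forall eps : R, 0 < eps ->
  forall d : nat, (0 < d)%N -> `|g d| <= K eps * d%:R `^ eps.

Definition sieve_function (R : realType) (K : R -> R) (Q : nat)
    (f : nat -> R) :=
  (forall d : nat, (Q < d)%N -> eratosthenes f d = 0) /\
  essentially_bounded K (eratosthenes f).

(* The filter "v N tends to infinity" on the index N: u =o_ (along v) v reads
   "u = o(v) as v -> oo".  It does not presuppose that v N tends to infinity
   with N; when it does, u N / v N -> 0 as N -> oo implies u =o_ (along v) v. *)
Definition along (v : nat -> nat) : set_system nat :=
  filter_from setT (fun M => [set N | (M <= v N)%N]).

Global Instance along_filter (v : nat -> nat) : Filter (along v).
Proof.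
apply: filter_from_filter; first by exists 0%N.
move=> i j _ _; exists (maxn i j) => // N /=.
by rewrite geq_max => /andP.
Qed.

Canonical along_filterType (v : nat -> nat) :=
  FilterType (along v) (along_filter v).

(* Main.v *)
Require Import Defs.
From mathcomp Require Import all_boot all_order all_algebra.
From mathcomp Require Import all_classical all_reals all_analysis.
From mathcomp Require Import zify ring lra complex.

Set Implicit Arguments.
Unset Strict Implicit.
Unset Printing Implicit Defensive.

Import Order.TTheory GRing.Theory Num.Theory.
Import numFieldNormedType.Exports.

Local Open Scope classical_set_scope.
Local Open Scope ring_scope.

(** Möbius inversion writes f(n) as the sum of g(d) over d | n, d <= Q, so the left-hand
    side is the sum over d <= Q of g(d) T(d), where T(d) is the discrepancy of the
    multiples of d in (N, 2N] with respect to the H residue classes.  Expanding the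
    congruence into additive characters modulo q, the trivial character cancels the
    main term, and the character of frequency j contributes a product of two geometric
    sums, of ratios e(jd/q) and e(jr/q).  Grouping d modulo q / gcd(j, q) bounds the sum
    over d by (N gcd(j, q) / q + Q + q) log; the sum over j then costs the number of
    divisors of q and another logarithm, which is N^eps as long as q <= N.
    When q > N, |T(d)| <= N/d + 1 is enough. *)

(** * Möbius inversion and divisor bounds *)

(** The cutoff [M] is free so that divisor sums of different integers can share one index range
    before an exchange of summations. *)
Lemma sum_divisors (R : realType) (F : nat -> R) (n M : nat) :
  (0 < n <= M)%N ->
  \sum_(d <- divisors n) F d = \sum_(1 <= d < M.+1 | (d %| n)%N) F d.
Proof.
move=> /andP[n_gt0 leM]; rewrite -[RHS]big_filter; apply: perm_big.
apply: uniq_perm; rewrite ?divisors_uniq ?filter_uniq ?iota_uniq // => d.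
rewrite mem_filter -dvdn_divisors // mem_index_iota ltnS.
case: (boolP (d %| n)%N) => //= dvd.
by rewrite (dvdn_gt0 n_gt0 dvd) (leq_trans (dvdn_leq n_gt0 dvd) leM).
Qed.

Lemma sum_divisors_multiples (R : realType) (F : nat -> R) (e n : nat) :
  (0 < n)%N -> (e %| n)%N ->
  \sum_(d <- divisors n | (e %| d)%N) F d
    = \sum_(k <- divisors (n %/ e)) F (e * k)%N.
Proof.
move=> n_gt0 edvd; have e_gt0 := dvdn_gt0 n_gt0 edvd.
have ne_gt0 : (0 < n %/ e)%N by rewrite divn_gt0 // dvdn_leq.
rewrite -[LHS]big_filter -(big_map (muln e) xpredT F); apply: perm_big.
apply: uniq_perm; rewrite ?filter_uniq ?divisors_uniq //.
  rewrite map_inj_uniq ?divisors_uniq // => x y /eqP.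
  by rewrite eqn_pmul2l // => /eqP.
move=> d; rewrite mem_filter -dvdn_divisors //; apply/andP/mapP.
  case=> /dvdnP[k ->] kdvd; exists k; last by rewrite mulnC.
  by rewrite -dvdn_divisors // dvdn_divRL.
case=> k; rewrite -dvdn_divisors // dvdn_divRL // => kdvd ->.
by rewrite dvdn_mulr // mulnC.
Qed.

Lemma mobius1 (R : realType) : mobius R 1 = 1.
Proof. by rewrite /mobius /= expr0. Qed.

Lemma mobius_square (R : realType) (p k : nat) :
  prime p -> (0 < k)%N -> (p %| k)%N -> mobius R (p * k) = 0.
Proof.
move=> p_pr k_gt0 pk; rewrite /mobius; case: ifP => // /allP /(_ p).
rewrite mem_primes p_pr muln_gt0 (prime_gt0 p_pr) k_gt0 dvdn_mulr //=.
rewrite (lognM _ (prime_gt0 p_pr) k_gt0) (logn_prime _ p_pr) eqxx => /(_ isT).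
have : (0 < logn p k)%N by rewrite logn_gt0 mem_primes p_pr k_gt0.
by lia.
Qed.

Lemma mobius_prime_mul (R : realType) (p k : nat) :
  prime p -> (0 < k)%N -> ~~ (p %| k)%N -> mobius R (p * k) = - mobius R k.
Proof.
move=> p_pr k_gt0 pk; have p_gt0 := prime_gt0 p_pr.
have pNk : p \notin primes k by rewrite mem_primes p_pr k_gt0.
have perm : perm_eq (primes (p * k)) (p :: primes k).
  apply: uniq_perm; rewrite /= ?primes_uniq ?pNk // => l.
  by rewrite primesM // primes_prime // !inE.
rewrite /mobius (perm_all _ perm) (perm_size perm) /=.
rewrite (lognM _ p_gt0 k_gt0) (logn_prime _ p_pr) eqxx.
rewrite logn_coprime ?prime_coprime // addn0 eqxx /=.
rewrite (@eq_in_all _ _ (fun l => logn l k == 1)%N) => [|l lk]; last first.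
  have l_pr : prime l by move: lk; rewrite mem_primes => /andP[].
  rewrite (lognM _ p_gt0 k_gt0) (logn_prime _ p_pr).
  by case: (l =P p) => // lp; rewrite -lp lk in pNk.
by case: ifP => _; rewrite ?oppr0 // exprS mulN1r.
Qed.

(* Divisors k prime to p cancel against p * k, p being a fixed prime divisor of n. *)
Lemma sum_mobius (R : realType) (n : nat) : (0 < n)%N ->
  \sum_(k <- divisors n) mobius R k = (n == 1)%N%:R.
Proof.
move=> n_gt0; have [->|n_neq1] := eqVneq n 1%N.
  by rewrite (_ : divisors 1 = [:: 1%N]) // big_seq1 mobius1.
have n_gt1 : (1 < n)%N by lia.
have [p p_pr pn] := pdivP n_gt1.
have np_gt0 : (0 < n %/ p)%N by rewrite divn_gt0 ?prime_gt0 // dvdn_leq.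
rewrite (bigID (fun k => p %| k)%N) /= (sum_divisors_multiples _ n_gt0 pn).
(* Among the divisors p k of n, those with p | k are divisible by p^2 and drop out. *)
rewrite [X in X + _](bigID (fun k => p %| k)%N) /= big_seq_cond big1 ?add0r; last first.
  move=> k /andP[]; rewrite -dvdn_divisors // => kn pk.
  by rewrite mobius_square // (dvdn_gt0 np_gt0 kn).
rewrite big_seq_cond (eq_bigr (fun k => - mobius R k)); last first.
  move=> k /andP[]; rewrite -dvdn_divisors // => kn pk.
  by rewrite mobius_prime_mul // (dvdn_gt0 np_gt0 kn).
rewrite -big_seq_cond sumrN addrC; apply/eqP; rewrite subr_eq0; apply/eqP.
rewrite -big_filter -[RHS]big_filter; apply: perm_big; apply: uniq_perm.
- by rewrite filter_uniq ?divisors_uniq.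
- by rewrite filter_uniq ?divisors_uniq.
move=> k; rewrite !mem_filter -!dvdn_divisors //.
case: (boolP (p %| k)%N) => //= pk.
by rewrite -{1}(divnK pn) Gauss_dvdl // coprime_sym prime_coprime.
Qed.

(** After exchanging the sums over e | d | n and writing d = e k, the coefficient of f(e) is the sum
    of the Möbius function over the divisors of n / e, so only e = n survives. *)
Lemma eratosthenes_inversion (R : realType) (f : nat -> R) (n : nat) :
  (0 < n)%N -> f n = \sum_(d <- divisors n) eratosthenes f d.
Proof.
move=> n_gt0; rewrite (@sum_divisors _ _ _ n) ?n_gt0 ?leqnn // big_nat_cond.
rewrite (eq_bigr (fun d => \sum_(1 <= e < n.+1 | (e %| d)%N)
   f e * mobius R (d %/ e))); last first.
  by move=> d /andP[/andP[d0 dn] _]; rewrite -sum_divisors ?d0.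
rewrite -big_nat_cond (exchange_big_dep_nat (fun e => e %| n)%N) /=; last first.
  by move=> d e _ _ dn ed; apply: dvdn_trans ed dn.
rewrite -(@sum_divisors _ (fun e => \sum_(1 <= d < n.+1 | (d %| n)%N && (e %| d)%N)
   f e * mobius R (d %/ e))) ?n_gt0 ?leqnn //.
rewrite (big_rem n) /=; last by rewrite -dvdn_divisors.
have inner e : (e %| n)%N ->
  \sum_(1 <= d < n.+1 | (d %| n)%N && (e %| d)%N) f e * mobius R (d %/ e)
  = f e * (n %/ e == 1)%N%:R.
  move=> en; have e_gt0 := dvdn_gt0 n_gt0 en.
  have ne_gt0 : (0 < n %/ e)%N by rewrite divn_gt0 // dvdn_leq.
  rewrite -sum_mobius // mulr_sumr big_mkcondr /=.
  rewrite -(@sum_divisors _ (fun d => if (e %| d)%N then _ else _)) ?n_gt0 ?leqnn //.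
  rewrite -big_mkcond sum_divisors_multiples //.
  by apply: eq_bigr => k _; rewrite mulKn.
rewrite inner // divnn n_gt0 mulr1 big_seq big1 ?addr0 // => e.
rewrite mem_rem_uniq ?divisors_uniq // inE -dvdn_divisors // => /andP[ne en].
rewrite inner // (_ : (_ == _) = false) ?mulr0 //.
by apply/negP => /eqP h; move: ne; rewrite -(divnK en) h mul1n eqxx.
Qed.

Lemma sieve_function_expand (R : realType) (K : R -> R) (Q : nat)
    (f : nat -> R) (n : nat) : sieve_function K Q f -> (0 < n)%N ->
  f n = \sum_(1 <= d < Q.+1 | (d %| n)%N) eratosthenes f d.
Proof.
move=> [g0 _] n_gt0; rewrite {1}(eratosthenes_inversion f n_gt0).
rewrite (@sum_divisors _ _ _ (maxn n Q)) ?n_gt0 ?leq_maxl //.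
rewrite (@big_cat_nat _ _ _ Q.+1) //= ?ltnS ?leq_maxr //.
rewrite [X in _ + X]big_nat_cond [X in _ + X]big1 ?addr0 // => d.
by move=> /andP[/andP[Qd _] _]; apply: g0.
Qed.

(** A divisor of p^a m is the product of its p-part, which divides p^a, and its p'-part, which
    divides m. *)
Lemma size_divisors_pfactor (p a m : nat) : prime p -> (0 < m)%N ->
  coprime p m -> (size (divisors (p ^ a * m)) <= a.+1 * size (divisors m))%N.
Proof.
move=> p_pr m_gt0 cop; have pa_gt0 : (0 < p ^ a)%N by rewrite expn_gt0 prime_gt0.
set l := [seq (p ^ i * d)%N | i <- iota 0 a.+1, d <- divisors m].
have <- : size l = (a.+1 * size (divisors m))%N by rewrite size_allpairs size_iota.
apply: uniq_leq_size; rewrite ?divisors_uniq // => d.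
rewrite -dvdn_divisors ?muln_gt0 ?pa_gt0 // => dn.
have d_gt0 : (0 < d)%N by apply: dvdn_gt0 dn; rewrite muln_gt0 pa_gt0.
have m_p' : ((p^')%N).-nat m by rewrite p'natE // -prime_coprime.
apply/allpairsP; exists (logn p d, d`_p^')%N; split.
- change (logn p d \in iota 0 a.+1); rewrite mem_iota add0n ltnS /=.
  have := dvdn_leq_log p _ dn; rewrite muln_gt0 pa_gt0 => /(_ m_gt0).
  by rewrite lognM // pfactorK // (logn_coprime cop) addn0.
- rewrite /= -dvdn_divisors //.
  have := partn_dvd (p^')%N _ dn; rewrite muln_gt0 pa_gt0 => /(_ m_gt0).
  rewrite partnM // [X in (X * _)%N]part_p'nat ?mul1n ?(part_pnat_id m_p') //.
  by rewrite pnatX (eq_pnat _ (negnK p)) pnat_id.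
- by rewrite /= -p_part partnC.
Qed.

(* A prime power p^a multiplies tau(n) / n^e by (a+1) / p^(a e), which is at most 1
   once p^e >= 2 and at most D otherwise; only P primes fall in the second case. *)
Lemma divisor_bound (R : realType) (e : R) : 0 < e ->
  exists C : R, forall n, (0 < n)%N -> (size (divisors n))%:R <= C * n%:R `^ e.
Proof.
move=> e_gt0; have ln2 : 0 < ln 2 :> R by apply: ln_gt0; lra.
(* [D] is chosen so that a + 1 <= D (1 + a e ln 2) <= D 2^(a e), the last step by exp x >= 1 + x. *)
set D : R := 1 + (e * ln 2)^-1.
have D_ge1 : 1 <= D by rewrite lerDl invr_ge0 mulr_ge0 ?ltW.
set P := (Num.truncn (2 `^ e^-1 : R)).+1.
have P_big (p : nat) : (P <= p)%N -> 2 <= p%:R `^ e :> R.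
  move=> Pp; have -> : 2 = (2 `^ e^-1) `^ e :> R.
    by rewrite -powRrM mulVf ?gt_eqF // powRr1.
  apply: ge0_ler_powR; rewrite ?ltW // ?nnegrE ?powR_ge0 ?ler0n //.
  apply: (lt_le_trans (truncnS_gt _)).
  by rewrite ler_nat.
have local_bound (p a : nat) : prime p ->
    a.+1%:R <= (if (p < P)%N then D else 1) * (p ^ a)%:R `^ e.
  move=> p_pr; have p_gt1 := prime_gt1 p_pr.
  have pa : (p ^ a)%:R `^ e = (p%:R `^ e) ^+ a :> R.
    by rewrite natrX -powR_mulrn ?ler0n // powRAC powR_mulrn ?powR_ge0.
  rewrite pa; case: ltnP => [_|/P_big p2]; last first.
    rewrite mul1r; apply: (@le_trans _ _ (2 ^+ a)); last first.
      by apply: lerXn2r; rewrite ?nnegrE ?powR_ge0.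
    by rewrite -natrX ler_nat ltn_expl.
  have p2 : 2 `^ e <= p%:R `^ e.
    by apply: ge0_ler_powR; rewrite ?nnegrE ?ler0n ?ler_nat //; apply: ltW.
  apply: (@le_trans _ _ (D * (2 `^ e) ^+ a)); last first.
    rewrite ler_wpM2l //; first by lra.
    by apply: lerXn2r; rewrite ?nnegrE ?powR_ge0.
  rewrite -powR_mulrn ?powR_ge0 // -powRrM /powR gt_eqF //.
  apply: (@le_trans _ _ (D * (1 + e * a%:R * ln 2))); last first.
    by rewrite ler_wpM2l ?expR_ge1Dx //; lra.
  have -> : D * (1 + e * a%:R * ln 2) = 1 + a%:R + (e * ln 2)^-1 + a%:R * (e * ln 2).
    by rewrite /D; field; rewrite !gt_eqF.
  rewrite -natr1 addrC -addrA lerDl addr_ge0 ?invr_ge0 ?mulr_ge0 ?ler0n ?ltW //.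
exists (D ^+ P) => n n_gt0.
(* The induction on n needs the exact number of prime divisors below [P] as exponent of [D]; it is
   replaced by [P] only at the end. *)
pose c n := count (fun p => p < P)%N (primes n).
have cP : (c n <= P)%N.
  rewrite /c -size_filter -[X in (_ <= X)%N](size_iota 0).
  apply: uniq_leq_size; first by rewrite filter_uniq ?primes_uniq.
  by move=> p; rewrite mem_filter mem_iota => /andP[].
apply: (@le_trans _ _ (D ^+ c n * n%:R `^ e)); last first.
  by rewrite ler_wpM2r ?powR_ge0 // ler_weXn2l.
elim/ltn_ind: n n_gt0 {cP} => n IH n_gt0.
have [n_le1|n_gt1] := leqP n 1.
  have -> : n = 1%N by lia.
  by rewrite powR1 mulr1 exprn_ege1.
have [p p_pr pn] := pdivP n_gt1.
have [m cop mn] := pfactor_coprime p_pr n_gt0.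
have a_gt0 : (0 < logn p n)%N by rewrite logn_gt0 mem_primes p_pr n_gt0 pn.
move: (logn p n) a_gt0 mn => a a_gt0 mn.
have m_gt0 : (0 < m)%N by case: (m) mn => [|//]; rewrite mul0n; lia.
have p_gt1 := prime_gt1 p_pr.
have lt_mn : (m < n)%N by rewrite mn ltn_Pmulr // -(expn0 p) ltn_exp2l.
have perm : perm_eq (primes n) (p :: primes m).
  apply: uniq_perm; rewrite /= ?primes_uniq ?andbT.
  - by [].
  - by rewrite mem_primes p_pr m_gt0 -prime_coprime.
  move=> l; rewrite mn primesM ?expn_gt0 ?(ltnW p_gt1) // primesX //.
  by rewrite (primes_prime p_pr) !inE orbC.
have cn : c n = ((p < P) + c m)%N by rewrite /c (permP perm).
have := size_divisors_pfactor a p_pr m_gt0 cop.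
rewrite [X in divisors X]mulnC -mn -(ler_nat R) natrM => /le_trans; apply.
rewrite cn exprD [X in X%:R `^ _]mn natrM powRM ?ler0n //.
have -> : D ^+ (p < P)%N * D ^+ c m * (m%:R `^ e * (p ^ a)%:R `^ e)
  = ((if (p < P)%N then D else 1) * (p ^ a)%:R `^ e) * (D ^+ c m * m%:R `^ e).
  move: (m%:R `^ e) ((p ^ a)%:R `^ e) (D ^+ c m) => x y w.
  by case: (p < P)%N; rewrite ?expr1 ?expr0 /=; ring.
apply: ler_pM; [exact: ler0n | exact: ler0n | exact: local_bound | exact: IH].
Qed.

(** * Harmonic sums *)

Definition harmonic_sum (R : realType) (n : nat) : R :=
  \sum_(1 <= k < n.+1) k%:R^-1.

Lemma harmonic_sum_ge0 (R : realType) (n : nat) : 0 <= harmonic_sum R n.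
Proof. by apply: sumr_ge0 => k _; rewrite invr_ge0 ler0n. Qed.

Lemma harmonic_sum_le (R : realType) (m n : nat) : (m <= n)%N ->
  harmonic_sum R m <= harmonic_sum R n.
Proof.
move=> mn; rewrite /harmonic_sum [leRHS](@big_cat_nat _ _ _ m.+1) //= lerDl.
by apply: sumr_ge0 => k _; rewrite invr_ge0 ler0n.
Qed.

Lemma harmonic_sum_ln (R : realType) (n : nat) : (0 < n)%N ->
  harmonic_sum R n <= 1 + ln n%:R.
Proof.
elim: n => // -[_ _|n IH _]; first by rewrite /harmonic_sum big_nat1 ln1 invr1; lra.
rewrite /harmonic_sum big_nat_recr //=.
have n1 : 0 < n.+1%:R :> R by rewrite ltr0n.
have n2 : 0 < n.+2%:R :> R by rewrite ltr0n.
have := IH isT; rewrite /harmonic_sum => h.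
(* The new term is at most the increment of the logarithm, by ln(1 - x) <= -x at x = 1 / (n + 2). *)
suff k : n.+2%:R^-1 <= ln n.+2%:R - ln n.+1%:R :> R.
  by apply: (le_trans (lerD h k)); rewrite -addrA (addrC (ln _)) subrK.
have E : n.+1%:R / n.+2%:R = 1 + - n.+2%:R^-1 :> R.
  rewrite -(natr1 n.+1); field.
  suff -> : 1 + n%:R + 1 = n.+2%:R :> R by rewrite gt_eqF.
  by rewrite -!natr1; ring.
have : ln (n.+1%:R / n.+2%:R) <= - n.+2%:R^-1 :> R.
  by rewrite E; apply: le_ln1Dx; rewrite ltrN2 invf_lt1 // ltr1n.
by rewrite ln_div ?posrE // lerNr opprB.
Qed.

(** Both terms of 1 + ln n are absorbed: 1 <= n^e, and e ln n = ln(n^e) <= n^e; hence the constant 1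
    + 1/e. *)
Lemma harmonic_sum_bound (R : realType) (e : R) : 0 < e ->
  exists C : R, forall n, (0 < n)%N -> harmonic_sum R n <= C * n%:R `^ e.
Proof.
move=> e_gt0; exists (1 + e^-1) => n n_gt0.
have n0 : 0 < n%:R :> R by rewrite ltr0n.
apply: (le_trans (harmonic_sum_ln R n_gt0)).
have n_ge1 : 1 <= n%:R `^ e :> R.
  rewrite -{1}(powRr0 n%:R); apply: ler_powR; last exact: ltW.
  by rewrite ler1n.
have : e * ln n%:R <= n%:R `^ e.
  by rewrite -ln_powR; apply/ltW/ln_sublinear/powR_gt0.
rewrite mulrC -ler_pdivlMr // mulrDl mul1r [_^-1 * _]mulrC; lra.
Qed.

(** * Additive characters modulo q *)

(** By induction on M - N: the quotient by d grows by one exactly when the new index is a multiple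
    of d. *)
Lemma sum_multiples (V : nmodType) (F : nat -> V) (d N M : nat) :
  (0 < d)%N -> (N <= M)%N ->
  \sum_(N.+1 <= n < M.+1 | (d %| n)%N) F n
    = \sum_((N %/ d).+1 <= m < (M %/ d).+1) F (d * m)%N.
Proof.
move=> d_gt0 /subnKC <-; elim: (M - N)%N => [|k IH].
  by rewrite addn0 !big_geq.
rewrite addnS big_mkcond big_nat_recr ?ltnS ?leq_addr //= -big_mkcond IH divnS //.
case: ifP => dk; last by rewrite addr0.
rewrite add1n [RHS]big_nat_recr ?ltnS ?leq_div2r ?leq_addr //=.
congr (_ + _); congr F.
by have := divnK dk; rewrite divnS // dk add1n mulnC => ->.
Qed.

(** The generic norm on [R[i]] has values in [R[i]]; this one lands in [R], where all estimates take
    place. *)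
Definition modulus (R : realType) (z : R[i]) : R := ComplexField.Normc.normc z.

Lemma modulus0 (R : realType) : modulus (0 : R[i]) = 0.
Proof. exact: ComplexField.Normc.normc0. Qed.

Lemma modulusM (R : realType) (x y : R[i]) : modulus (x * y) = modulus x * modulus y.
Proof. exact: ComplexField.Normc.normcM. Qed.

Lemma modulusV (R : realType) (x : R[i]) : modulus x^-1 = (modulus x)^-1.
Proof. exact: ComplexField.Normc.normcV. Qed.

Lemma modulusN (R : realType) (x : R[i]) : modulus (- x) = modulus x.
Proof. exact: normcN. Qed.

Lemma modulusD (R : realType) (x y : R[i]) : modulus (x + y) <= modulus x + modulus y.
Proof. exact: le_normcD. Qed.

Lemma modulus_ge0 (R : realType) (x : R[i]) : 0 <= modulus x.
Proof. by case: x => a b; apply: sqrtr_ge0. Qed.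

Lemma modulus_sum (R : realType) (I : Type) (r : seq I) (P : pred I) (F : I -> R[i]) :
  modulus (\sum_(i <- r | P i) F i) <= \sum_(i <- r | P i) modulus (F i).
Proof.
elim: r => [|i r IH]; first by rewrite !big_nil modulus0.
rewrite !big_cons; case: ifP => // _.
by apply: (le_trans (modulusD _ _)); apply: lerD.
Qed.

Lemma modulus_real (R : realType) (x : R) : modulus (x%:C)%C = `|x|.
Proof. by rewrite /modulus /= expr0n /= addr0 sqrtr_sqr. Qed.

Definition expi (R : realType) (x : R) : R[i] := (cos x +i* sin x)%C.

Lemma modulus_expi (R : realType) (x : R) : modulus (expi x) = 1.
Proof. by rewrite /modulus /= cos2Dsin2 sqrtr1. Qed.

Lemma expiD (R : realType) (x y : R) : expi (x + y) = expi x * expi y.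
Proof.
by apply/eqP; rewrite /expi cosD sinD eq_complex /= eqxx addrC eqxx.
Qed.

Lemma expi0 (R : realType) : expi (0 : R) = 1.
Proof. by rewrite /expi cos0 sin0. Qed.

Lemma expiX (R : realType) (x : R) (n : nat) : expi x ^+ n = expi (x *+ n).
Proof.
elim: n => [|n IH]; first by rewrite expr0 mulr0n expi0.
by rewrite exprS IH mulrS expiD.
Qed.

Lemma modulus_expi_sub1 (R : realType) (x : R) :
  modulus (expi (x *+ 2) - 1) = 2 * `|sin x|.
Proof.
rewrite /modulus /= cos_mulr2n sin_mulr2n subr0.
have -> : (cos x ^+ 2 *+ 2 - 1 - 1) ^+ 2 + (cos x * sin x *+ 2) ^+ 2
  = (2 * sin x) ^+ 2.
  have -> : (cos x * sin x *+ 2) ^+ 2 = cos x ^+ 2 * sin x ^+ 2 *+ 4 by ring.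
  by rewrite cos2sin2; ring.
by rewrite sqrtr_sqr normrM ger0_norm.
Qed.

(** With y = x / 2, sin x = 2 sin y cos y, and the mean value theorem gives sin y = y cos c; both
    cosines are at least 1/2 because y <= pi / 4. The constant 1/4 is not sharp. *)
Lemma sin_lower_bound (R : realType) (x : R) : 0 <= x <= pi / 2 -> x / 4 <= sin x.
Proof.
move=> /andP[x0 x1]; set y := x / 2.
have y0 : 0 <= y by rewrite /y; lra.
have y1 : y *+ 2 <= pi / 2 by rewrite /y; lra.
have cos_ge c : 0 <= c <= y -> 1 / 2 <= cos c.
  move=> /andP[c0 cy].
  have h1 : 0 <= cos c by apply: cos_ge0_pihalf; lra.
  have : 0 <= cos (c *+ 2) by apply: cos_ge0_pihalf; lra.
  rewrite cos_mulr2n; nra.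
have [c cy] : exists2 c, c \in `[0, y] & sin y - sin 0 = cos c * (y - 0).
  apply: MVT_segment => //.
  apply: continuous_subspaceT => z; exact: continuous_sin.
rewrite sin0 !subr0 => siny.
have h1 : 1 / 2 <= cos c by apply: cos_ge; rewrite in_itv /= in cy.
have h2 : 1 / 2 <= cos y by apply: cos_ge; rewrite y0 lexx.
have -> : x = y *+ 2 by rewrite /y; lra.
have : 0 <= (cos y * cos c - 1 / 4) * y by apply: mulr_ge0 => //; nra.
by rewrite sin_mulr2n siny; nra.
Qed.

(** The number e(1/q), with its angle written as a double so that [modulus_expi_sub1] applies with
    half-angle pi / q. *)
Definition root_of_unity (R : realType) (q : nat) : R[i] := expi (pi / q%:R *+ 2).

Lemma root_of_unity_order (R : realType) (q : nat) : (0 < q)%N ->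
  root_of_unity R q ^+ q = 1.
Proof.
move=> q_gt0; rewrite expiX -mulrnA mulnC mulrnA -[_ *+ q]mulr_natr divfK.
  by rewrite /expi cos2pi sin2pi.
by rewrite pnatr_eq0 -lt0n.
Qed.

Lemma root_of_unity_mod (R : realType) (q k : nat) : (0 < q)%N ->
  root_of_unity R q ^+ k = root_of_unity R q ^+ (k %% q).
Proof.
move=> q_gt0; rewrite {1}(divn_eq k q) exprD mulnC exprM root_of_unity_order //.
by rewrite expr1n mul1r.
Qed.

Lemma modulus_root_of_unity (R : realType) (q k : nat) :
  modulus (root_of_unity R q ^+ k) = 1.
Proof. by rewrite expiX modulus_expi. Qed.

(* Comparable to the inverse of the distance from s to q Z; when s = 0 the first
   summand is the junk value 0. *)
Definition inv_dist (R : realType) (q s : nat) : R := s%:R^-1 + (q - s)%:R^-1.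

Lemma inv_dist_ge0 (R : realType) (q s : nat) : 0 <= inv_dist R q s.
Proof. by rewrite addr_ge0 ?invr_ge0 ?ler0n. Qed.

(** For s <= q / 2 the linear lower bound and pi >= 2 give sin(pi s / q) >= s / (2 q); larger s
    reduce to this by sin(pi - x) = sin x. One summand of [inv_dist] suffices each time. *)
Lemma sin_inv_dist (R : realType) (q s : nat) : (0 < s < q)%N ->
  1 <= `|sin (pi / q%:R *+ s : R)| * (2 * q%:R * inv_dist R q s).
Proof.
have half (t : nat) : (0 < t)%N -> (t.*2 <= q)%N ->
    1 <= `|sin (pi / q%:R *+ t : R)| * (2 * q%:R * t%:R^-1).
  move=> t_gt0 tq; have q_gt0 : (0 < q)%N by lia.
  have t0 : 0 < t%:R :> R by rewrite ltr0n.
  have q0 : 0 < q%:R :> R by rewrite ltr0n.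
  have tqR : t%:R + t%:R <= q%:R :> R by rewrite -natrD ler_nat addnn.
  have xE : pi / q%:R *+ t = pi * (t%:R / q%:R) :> R.
    by rewrite -mulr_natr mulrAC mulrA.
  have tq2 : t%:R / q%:R <= 1 / 2 :> R by rewrite ler_pdivrMr //; lra.
  have tq0 : 0 < t%:R / q%:R :> R by rewrite divr_gt0.
  have pi2 := pi_ge2 R.
  have : pi / q%:R *+ t / 4 <= sin (pi / q%:R *+ t) :> R.
    by apply: sin_lower_bound; rewrite xE; nra.
  move=> h; apply: (@le_trans _ _ ((t%:R / q%:R / 2) * (2 * q%:R * t%:R^-1))).
    by rewrite le_eqVlt; apply/orP; left; apply/eqP; field; rewrite !gt_eqF.
  apply: ler_wpM2r; first by rewrite !mulr_ge0 ?invr_ge0 ?ler0n.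
  by apply: le_trans (ler_norm _); apply: le_trans h; rewrite xE; nra.
move=> /andP[s_gt0 sq].
have nz (t : nat) : 0 <= t%:R^-1 :> R by rewrite invr_ge0 ler0n.
have q0 : 0 < q%:R :> R by rewrite ltr0n; lia.
have [h|h] := leqP s.*2 q.
  apply: (le_trans (half s s_gt0 h)).
  by rewrite ler_wpM2l // ler_wpM2l ?lerDl ?nz // mulr_ge0 ?ler0n.
have -> : sin (pi / q%:R *+ s) = sin (pi / q%:R *+ (q - s)) :> R.
  have : pi / q%:R *+ q = pi :> R by rewrite -mulr_natr divfK ?gt_eqF.
  move: (pi / q%:R) => x xq; rewrite mulrnBr ?(ltnW sq) // xq.
  by rewrite sinB sinpi cospi; ring.
apply: (le_trans (half (q - s)%N _ _)); [lia | lia |].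
by rewrite ler_wpM2l // ler_wpM2l ?lerDr ?nz // mulr_ge0 ?ler0n.
Qed.

Lemma root_of_unity_sub1 (R : realType) (q k : nat) : (0 < q)%N -> ~~ (q %| k)%N ->
  2 <= modulus (root_of_unity R q ^+ k - 1) * (2 * q%:R * inv_dist R q (k %% q)).
Proof.
move=> q_gt0 qk; rewrite root_of_unity_mod // expiX -mulrnA mulnC mulrnA.
rewrite modulus_expi_sub1; set W := 2 * q%:R * _; rewrite -mulrA; apply: ler_peMr => //.
by apply: sin_inv_dist; rewrite ltn_mod q_gt0 lt0n andbT.
Qed.

Lemma telescope_geometric (V : comNzRingType) (z : V) (A B : nat) : (A <= B)%N ->
  (z - 1) * \sum_(A <= m < B) z ^+ m = z ^+ B - z ^+ A.
Proof.
move=> AB; rewrite -(telescope_sumr _ AB) mulr_sumr; apply: eq_bigr => m _.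
by rewrite exprS mulrBl mul1r.
Qed.

Definition exp_sum (R : realType) (q k A B : nat) : R :=
  modulus (\sum_(A <= m < B) root_of_unity R q ^+ (k * m)).

(** Telescoping bounds the sum times z^k - 1 by 2, and the modulus of z^k - 1 times the right-hand
    side is at least 2. *)
Lemma exp_sum_le_inv_dist (R : realType) (q k A B : nat) :
  (0 < q)%N -> ~~ (q %| k)%N -> (A <= B)%N ->
  exp_sum R q k A B <= 2 * q%:R * inv_dist R q (k %% q).
Proof.
move=> q_gt0 qk AB; rewrite /exp_sum; set z := root_of_unity R q.
under eq_bigr do rewrite exprM.
set S := \sum_(_ <= _ < _) _.
have := root_of_unity_sub1 R q_gt0 qk; rewrite -/z.
set W := 2 * _ * _ => h.
have W0 : 0 <= W by rewrite !mulr_ge0 ?ler0n ?inv_dist_ge0.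
have : modulus (z ^+ k - 1) * modulus S <= 2.
  rewrite -modulusM telescope_geometric //.
  apply: (le_trans (modulusD _ _)).
  by rewrite modulusN -!exprM !modulus_root_of_unity.
have S0 := modulus_ge0 S.
move=> k2; nra.
Qed.

Lemma exp_sum_le_size (R : realType) (q k A B : nat) :
  exp_sum R q k A B <= (B - A)%:R.
Proof.
apply: (le_trans (modulus_sum _ _ _)).
under eq_bigr do rewrite modulus_root_of_unity.
by rewrite big_const_nat iter_addr_0.
Qed.

Lemma exp_sum_ge0 (R : realType) (q k A B : nat) : 0 <= exp_sum R q k A B.
Proof. by rewrite /exp_sum; case: (\sum_(_ <= _ < _) _) => a b; apply: sqrtr_ge0. Qed.

Lemma root_of_unity_orthogonality (R : realType) (q k : nat) : (0 < q)%N ->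
  \sum_(0 <= j < q) root_of_unity R q ^+ (j * k) = q%:R * (q %| k)%N%:R.
Proof.
move=> q_gt0; set z := root_of_unity R q.
under eq_bigr do rewrite mulnC exprM.
case: (boolP (q %| k)%N) => [/dvdnP[t ->]|qk].
  rewrite mulnC exprM root_of_unity_order // expr1n.
  under eq_bigr do rewrite expr1n.
  by rewrite big_const_nat iter_addr_0 subn0 mulr1.
rewrite mulr0; have := telescope_geometric (z ^+ k) (leq0n q).
rewrite expr0 -exprM mulnC exprM root_of_unity_order // expr1n subrr.
move/eqP; rewrite mulf_eq0 => /orP[/eqP z1|/eqP //].
(* If z^k were 1, the lower bound for the modulus of z^k - 1 would read 2 <= 0. *)
have := root_of_unity_sub1 R q_gt0 qk; rewrite -/z z1.
by rewrite modulus0 mul0r => h; exfalso; move: h; lra.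
Qed.

Lemma discrepancy_fourier (R : realType) (q s c H N M d : nat) :
  (0 < q)%N -> (0 < d)%N -> (N <= M)%N ->
  `| \sum_(N.+1 <= n < M.+1 | (d %| n)%N)
       (\sum_(1 <= a < H.+1) (q %| n + a * s + c)%N%:R - H%:R / q%:R) |
  <= q%:R^-1 * \sum_(1 <= j < q)
       exp_sum R q (j * d) (N %/ d).+1 (M %/ d).+1
       * exp_sum R q (j * s) 1 H.+1 :> R.
Proof.
move=> q_gt0 d_gt0 NM; set z := root_of_unity R q.
have qC : q%:R != 0 :> R[i] by rewrite pnatr_eq0 -lt0n.
(* The frequency j = 0 is split off: its 1/q, summed over the H values of a, cancels H/q. *)
have ind k : (q %| k)%N%:R = q%:R^-1 + q%:R^-1 * \sum_(1 <= j < q) z ^+ (j * k) :> R[i].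
  apply: (mulfI qC); rewrite -root_of_unity_orthogonality // big_ltn //.
  by rewrite mul0n expr0 mulrDr mulVKf // mulfV.
rewrite -modulus_real rmorph_sum.
rewrite (eq_bigr (fun n => q%:R^-1 * \sum_(1 <= j < q) \sum_(1 <= a < H.+1)
    (z ^+ (j * c) * z ^+ (j * n) * z ^+ (j * s * a)))) => [|n _]; last first.
  rewrite rmorphB rmorph_sum /= rmorphM fmorphV !rmorph_nat.
  under eq_bigr do rewrite rmorph_nat ind.
  rewrite big_split /= big_const_nat iter_addr_0 subn1 /= -(mulr_natl q%:R^-1 H) addrAC subrr add0r.
  rewrite -mulr_sumr exchange_big; congr (_ * _).
  apply: eq_bigr => j _; apply: eq_bigr => a _.
  by rewrite -!exprD; congr (_ ^+ _); ring.
rewrite -mulr_sumr modulusM modulusV.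
have -> : modulus (q%:R : R[i]) = q%:R.
  by rewrite -(rmorph_nat (real_complex R)) modulus_real normr_nat.
rewrite ler_wpM2l ?invr_ge0 ?ler0n // exchange_big /=.
apply: (le_trans (modulus_sum _ _ _)); apply: ler_sum => j _.
(* For fixed j the double sum factors, and n = d m turns the sum over n into a geometric sum in m of
   ratio e(j d / q). *)
have -> : \sum_(N.+1 <= n < M.+1 | (d %| n)%N) \sum_(1 <= a < H.+1)
    z ^+ (j * c) * z ^+ (j * n) * z ^+ (j * s * a)
  = z ^+ (j * c) * (\sum_((N %/ d).+1 <= m < (M %/ d).+1) z ^+ (j * d * m))
    * \sum_(1 <= a < H.+1) z ^+ (j * s * a).
  under eq_bigr do rewrite -mulr_sumr.
  rewrite -mulr_suml -mulr_sumr sum_multiples //.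
  by congr (_ * _ * _); apply: eq_bigr => m _; rewrite mulnA.
by rewrite !modulusM modulus_root_of_unity mul1r.
Qed.

(** * Averages of geometric sums *)

(** Multiplication by a unit permutes the residues modulo v; on a finite set injectivity is
    enough. *)
Lemma sum_mod_coprime (R : realType) (F : nat -> R) (u v : nat) :
  (0 < v)%N -> coprime u v ->
  \sum_(0 <= s < v) F ((u * s) %% v)%N = \sum_(0 <= s < v) F s.
Proof.
move=> v_gt0 cop; rewrite !big_mkord.
pose h (i : 'I_v) := Ordinal (ltn_pmod (u * i) v_gt0).
have aux (i j : 'I_v) : (i <= j)%N -> h i = h j -> i = j.
  move=> ij /(congr1 val) /= /esym/eqP; rewrite eqn_mod_dvd ?leq_mul //.
  rewrite -mulnBr Gauss_dvdr 1?coprime_sym // => dv.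
  apply/val_inj/eqP; rewrite eqn_leq ij -subn_eq0 /=.
  apply: contraTT dv; rewrite -lt0n => d_gt0; rewrite gtnNdvd //.
  by apply: leq_ltn_trans (ltn_ord j); apply: leq_subr.
have h_inj : injective h.
  move=> i j hij; case/orP: (leq_total i j) => ij; first exact: aux.
  by apply/esym; apply: aux.
by rewrite [RHS](reindex_inj h_inj).
Qed.

Lemma sum_periodic (R : realType) (F : nat -> R) (v K : nat) :
  (forall s, F (s %% v)%N = F s) ->
  \sum_(0 <= d < v * K) F d = K%:R * \sum_(0 <= s < v) F s.
Proof.
move=> per; elim: K => [|K IH]; first by rewrite muln0 big_geq // mul0r.
rewrite (@big_cat_nat _ _ _ (v * K)) ?leq_mul //= IH.
rewrite -{1}[(v * K)%N]add0n big_addn mulnS addnK -natr1 mulrDl mul1r.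
congr (_ + _); apply: eq_bigr => s _.
by rewrite -per addnC mulnC modnMDl per.
Qed.

(** The reflection s -> v - s exchanges the two summands of [inv_dist]. *)
Lemma sum_inv_dist (R : realType) (v : nat) :
  \sum_(1 <= s < v) inv_dist R v s = 2 * \sum_(1 <= s < v) s%:R^-1.
Proof.
rewrite big_split /= mulr_natl mulr2n; congr (_ + _).
rewrite big_nat_rev /=; apply: eq_big_nat => s /andP[s_gt0 sv].
by congr (_%:R^-1); lia.
Qed.

Lemma sum_inv_dist_le (R : realType) (v : nat) :
  \sum_(1 <= s < v) inv_dist R v s <= 2 * harmonic_sum R v.
Proof.
rewrite sum_inv_dist ler_wpM2l //; case: v => [|v].
  by rewrite big_geq // harmonic_sum_ge0.
by apply: harmonic_sum_le.
Qed.

Lemma inv_distM (R : realType) (g v s : nat) :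
  inv_dist R (g * v) (g * s) = g%:R^-1 * inv_dist R v s.
Proof. by rewrite /inv_dist -mulnBr !natrM !invfM mulrDr. Qed.

Lemma count_multiples_le (R : realType) (N d : nat) : (0 < d)%N ->
  ((2 * N %/ d).+1 - (N %/ d).+1)%:R <= N%:R / d%:R + 1 :> R.
Proof.
move=> d_gt0; apply: (@le_trans _ _ ((N %/ d).+1)%:R).
  rewrite ler_nat mul2n -addnn; have := leq_divDl d N N.
  by move: ((N + N) %/ d)%N (N %/ d)%N => x y; lia.
rewrite -natr1 lerD2r ler_pdivlMr ?ltr0n // -natrM ler_nat; exact: leq_trunc_div.
Qed.

(** Write j = g u and q = g v with g = gcd(j, q), so the ratio e(j d / q) = e(u d / v) depends only
    on d modulo v. If v does not divide d, the geometric bound applies, and each block of v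
    consecutive d costs at most 4 v times the harmonic sum of v. If v | d, the terms are merely
    counted. *)
Lemma sum_exp_sum_le (R : realType) (q j N Q v : nat) : (0 < q)%N ->
  v = (q %/ gcdn j q)%N ->
  \sum_(1 <= d < Q.+1) exp_sum R q (j * d) (N %/ d).+1 (2 * N %/ d).+1
    <= 4 * (Q%:R + v%:R) * harmonic_sum R v + (N%:R / v%:R * harmonic_sum R Q + Q%:R).
Proof.
set g := gcdn j q => q_gt0 vE.
have g_gt0 : (0 < g)%N by rewrite gcdn_gt0 q_gt0 orbT.
set u := (j %/ g)%N.
have jE : j = (g * u)%N by rewrite mulnC divnK // dvdn_gcdl.
have qE : q = (g * v)%N by rewrite vE mulnC divnK // dvdn_gcdr.
have v_gt0 : (0 < v)%N by move: q_gt0; rewrite qE muln_gt0 => /andP[].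
have cop : coprime u v.
  rewrite /coprime -(eqn_pmul2l g_gt0) muln1 muln_gcdr -jE -qE; exact/eqP.
have dvdE d : (q %| j * d)%N = (v %| d)%N.
  by rewrite jE qE -mulnA dvdn_pmul2l // Gauss_dvdr // coprime_sym.
(* Residue 0 gets the value 0 in place of the junk value of [inv_dist]; it corresponds to the
   multiples of v, which are treated apart. *)
pose G s : R := if s == 0%N then 0 else 2 * v%:R * inv_dist R v s.
have G_ge0 s : 0 <= G s.
  by rewrite /G; case: ifP => // _; rewrite !mulr_ge0 ?ler0n ?inv_dist_ge0.
pose G' d := G ((u * d) %% v)%N.
apply: (@le_trans _ _ (\sum_(1 <= d < Q.+1) G' d +
    \sum_(1 <= d < Q.+1 | (v %| d)%N) (N%:R / d%:R + 1))).
  rewrite [X in _ + X]big_mkcond -big_split /= big_nat_cond [leRHS]big_nat_cond.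
  apply: ler_sum => d /andP[/andP[d_gt0 _] _].
  have le_floor : ((N %/ d).+1 <= (2 * N %/ d).+1)%N.
    by rewrite ltnS leq_div2r // leq_pmull.
  case: ifP => vd.
    apply: (le_trans (exp_sum_le_size _ _ _ _ _)).
    by apply: (le_trans (count_multiples_le R N d_gt0)); rewrite lerDr; apply: G_ge0.
  rewrite addr0; have qjd : ~~ (q %| j * d)%N by rewrite dvdE vd.
  apply: (le_trans (exp_sum_le_inv_dist R q_gt0 qjd le_floor)).
  have -> : ((j * d) %% q = g * ((u * d) %% v))%N.
    by rewrite jE -mulnA {1}qE -muln_modr.
  rewrite /G' /G; case: eqP => [s0|_].
    by have := dvdE d; rewrite vd /dvdn jE -mulnA {1}qE -muln_modr s0 muln0 eqxx.
  rewrite {1 2}qE inv_distM natrM le_eqVlt; apply/orP; left; apply/eqP.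
  by field; rewrite pnatr_eq0 -lt0n.
apply: lerD.
  (* The range is enlarged to floor(Q / v) + 1 full periods starting at d = 0, which is harmless as
     all terms are nonnegative. *)
  apply: (@le_trans _ _ (\sum_(0 <= d < v * (Q %/ v).+1) G' d)).
    rewrite (@big_cat_nat _ _ _ 1 0) //= ?muln_gt0 ?v_gt0 //.
    rewrite (@big_cat_nat _ _ _ Q.+1 1 (v * _)) //=; last first.
      by rewrite mulnC; apply: ltn_ceil.
    by rewrite addrCA lerDl addr_ge0 ?sumr_ge0 // => d _; apply: G_ge0.
  rewrite sum_periodic; last by move=> s; rewrite /G' modnMmr.
  rewrite sum_mod_coprime // big_ltn // {1}/G eqxx add0r.
  rewrite (eq_big_nat _ _ (F2 := fun s => 2 * v%:R * inv_dist R v s)); last first.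
    by move=> s /andP[s_gt0 _]; rewrite /G gtn_eqF.
  rewrite -mulr_sumr.
  have h1 := sum_inv_dist_le R v.
  have h2 : (Q %/ v).+1%:R * v%:R <= Q%:R + v%:R :> R.
    by rewrite -natrM -natrD ler_nat mulSn addnC leq_add2r leq_trunc_div.
  have h0 := harmonic_sum_ge0 R v.
  have q0 : 0 <= (Q %/ v).+1%:R * v%:R :> R by rewrite mulr_ge0 ?ler0n.
  move: h1 h2 h0 q0; set S := \sum_(_ <= _ < _) _; move: (harmonic_sum R v) => h.
  move: ((Q %/ v).+1%:R) (v%:R) (Q%:R) => a b w h1 h2 h0 q0.
  apply: (@le_trans _ _ (2 * (a * b) * (2 * h))).
    have -> : a * (2 * b * S) = 2 * (a * b) * S by ring.
    by rewrite ler_wpM2l // mulr_ge0.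
  have -> : 2 * (a * b) * (2 * h) = 4 * (a * b) * h by ring.
  by rewrite ler_wpM2r // ler_wpM2l.
rewrite (sum_multiples (fun d => N%:R / d%:R + 1) v_gt0 (leq0n Q)) div0n.
rewrite big_split /=; apply: lerD.
  under eq_bigr do rewrite natrM invfM mulrA.
  rewrite -mulr_sumr ler_wpM2l ?divr_ge0 ?ler0n //.
  by apply: harmonic_sum_le; apply: leq_div.
by rewrite big_const_nat iter_addr_0 subn1 ler_nat leq_div.
Qed.

(** The gcd is one of the common divisors t of i and q, so it is at most their sum; after
    exchanging, i = t k turns t / i into 1 / k, and each t | q costs one harmonic sum. *)
Lemma sum_gcd_inv_le (R : realType) (q : nat) : (0 < q)%N ->
  \sum_(1 <= i < q) (gcdn i q)%:R / i%:R
    <= (size (divisors q))%:R * harmonic_sum R q.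
Proof.
move=> q_gt0.
have term_ge0 (t i : nat) : 0 <= t%:R / i%:R :> R by rewrite divr_ge0 ?ler0n.
apply: (@le_trans _ _ (\sum_(1 <= i < q.+1) \sum_(t <- divisors q | (t %| i)%N) t%:R / i%:R)).
  rewrite [leRHS]big_nat_recr //=.
  apply: (@le_trans _ _ (\sum_(1 <= i < q) \sum_(t <- divisors q | (t %| i)%N) t%:R / i%:R)).
    apply: ler_sum => i _.
    rewrite (big_rem (gcdn i q)) /= ?dvdn_gcdl; last first.
      by rewrite -dvdn_divisors // dvdn_gcdr.
    by rewrite lerDl; apply: sumr_ge0.
  by rewrite lerDl; apply: sumr_ge0.
rewrite (exchange_big_dep xpredT) //=.
have -> : (size (divisors q))%:R * harmonic_sum R q
    = \sum_(t <- divisors q) harmonic_sum R q.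
  by rewrite big_const_seq count_predT iter_addr_0 mulr_natl.
rewrite big_seq [leRHS]big_seq; apply: ler_sum => t.
rewrite -dvdn_divisors // => tq; have t_gt0 := dvdn_gt0 q_gt0 tq.
rewrite (sum_multiples (fun i => t%:R / i%:R) t_gt0 (leq0n q)) div0n.
rewrite (eq_bigr (fun k => k%:R^-1)) => [|k _]; last first.
  by rewrite natrM invfM mulVKf // pnatr_eq0 -lt0n.
by apply: harmonic_sum_le; apply: leq_div.
Qed.

(** The reflection i -> q - i preserves gcd(i, q), so both summands of [inv_dist] contribute
    equally. *)
Lemma sum_inv_dist_gcd_le (R : realType) (q : nat) : (0 < q)%N ->
  \sum_(1 <= i < q) inv_dist R q i * (gcdn i q)%:R
    <= 2 * ((size (divisors q))%:R * harmonic_sum R q).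
Proof.
move=> q_gt0.
have -> : \sum_(1 <= i < q) inv_dist R q i * (gcdn i q)%:R
    = 2 * \sum_(1 <= i < q) (gcdn i q)%:R / i%:R.
  under eq_bigr do rewrite /inv_dist mulrDl.
  rewrite big_split /= mulr_natl mulr2n; congr (_ + _).
    by apply: eq_bigr => i _; rewrite mulrC.
  rewrite big_nat_rev /=; apply: eq_big_nat => i /andP[i_gt0 iq].
  rewrite mulrC; congr (_%:R / _%:R); last by lia.
  have -> : (1 + q - i.+1 = q - i)%N by lia.
  by rewrite -{2 3}(subnK (ltnW iq)) gcdnDl [in RHS]gcdnDr gcdnC.
by rewrite ler_wpM2l // sum_gcd_inv_le.
Qed.

(** Multiplication by s permutes the residues modulo q and fixes 0, so the term at 0 cancels. *)
Lemma sum_coprime_shift (R : realType) (F : nat -> R) (q s : nat) : (0 < q)%N ->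
  coprime s q ->
  \sum_(1 <= j < q) F ((j * s) %% q)%N = \sum_(1 <= i < q) F i.
Proof.
move=> q_gt0 cop; have := sum_mod_coprime F q_gt0 cop.
rewrite !(big_ltn q_gt0) muln0 mod0n => /addrI <-.
by apply: eq_bigr => j _; rewrite mulnC.
Qed.

(** Reduces the bound of [sum_exp_sum_le], where A stands for N gcd(j, q) / q, to a single factor L;
    the 5 is the total coefficient 4 + 1 of Q. *)
Lemma inner_sum_arith (R : realType) (A hv hQ v q Q L : R) :
  0 <= A -> 0 <= hv <= L -> 0 <= hQ <= L -> 0 <= v <= q -> 0 <= Q -> 1 <= L ->
  4 * (Q + v) * hv + (A * hQ + Q) <= 5 * L * (A + Q + q).
Proof.
move=> A0 /andP[hv0 hvL] /andP[hQ0 hQL] /andP[v0 vq] Q0 L1.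
have e1 : (Q + v) * hv <= (Q + q) * L by apply: ler_pM; lra.
have e2 : A * hQ <= A * L by apply: ler_wpM2l.
have e3 : Q <= Q * L by apply: ler_peMr.
have e4 : 0 <= A * L by apply: mulr_ge0 => //; lra.
have e5 : 0 <= q * L by apply: mulr_ge0; lra.
by nra.
Qed.

(** One factor L comes from the sum over d, the other two from the number of divisors of q times a
    harmonic sum in the sum over j. The constant is 20 = 2 * 5 * 2. *)
Lemma discrepancy_sum_le (R : realType) (q s c H N Q : nat) (L : R) :
  (0 < q)%N -> coprime s q -> 1 <= L ->
  harmonic_sum R q <= L -> harmonic_sum R Q <= L -> (size (divisors q))%:R <= L ->
  \sum_(1 <= d < Q.+1) `| \sum_(N.+1 <= n < (2 * N).+1 | (d %| n)%N)
       (\sum_(1 <= a < H.+1) (q %| n + a * s + c)%N%:R - H%:R / q%:R) |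
  <= 20 * L ^+ 3 * (N%:R / q%:R + q%:R + Q%:R).
Proof.
move=> q_gt0 cop L_ge1 hq hQ tq.
have q0 : 0 < q%:R :> R by rewrite ltr0n.
have N0 : 0 <= N%:R / q%:R :> R by rewrite divr_ge0 ?ler0n.
have L0 : 0 <= L by lra.
pose Phi i : R := N%:R / q%:R * (gcdn i q)%:R + Q%:R + q%:R.
apply: (@le_trans _ _ (q%:R^-1 * \sum_(1 <= j < q) (2 * q%:R * inv_dist R q ((j * s) %% q)) *
     (5 * L * Phi j))).
  apply: (@le_trans _ _ (\sum_(1 <= d < Q.+1) (q%:R^-1 * \sum_(1 <= j < q)
       exp_sum R q (j * d) (N %/ d).+1 (2 * N %/ d).+1 * exp_sum R q (j * s) 1 H.+1))).
    rewrite big_nat_cond [leRHS]big_nat_cond; apply: ler_sum => d /andP[/andP[d_gt0 _] _].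
    by apply: discrepancy_fourier => //; rewrite leq_pmull.
  rewrite -mulr_sumr ler_wpM2l ?invr_ge0 ?ler0n // exchange_big /=.
  rewrite big_nat_cond [leRHS]big_nat_cond; apply: ler_sum => j /andP[/andP[j_gt0 jq] _].
  rewrite -mulr_suml mulrC; apply: ler_pM.
  - exact: exp_sum_ge0.
  - by apply: sumr_ge0 => d _; apply: exp_sum_ge0.
  - apply: exp_sum_le_inv_dist => //.
    by rewrite Gauss_dvdl 1?coprime_sym // gtnNdvd.
  apply: (le_trans (sum_exp_sum_le R N Q q_gt0 (erefl (q %/ gcdn j q)%N))).
  set g := gcdn j q; set v := (q %/ g)%N.
  have g_gt0 : (0 < g)%N by rewrite gcdn_gt0 j_gt0.
  have qE : q = (v * g)%N by rewrite divnK // dvdn_gcdr.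
  have vq : (v <= q)%N by apply: leq_div.
  have v_gt0 : (0 < v)%N by move: q_gt0; rewrite qE muln_gt0 => /andP[].
  have -> : N%:R / v%:R = N%:R / q%:R * g%:R :> R.
    by rewrite qE natrM; field; rewrite !pnatr_eq0 -!lt0n v_gt0 g_gt0.
  apply: inner_sum_arith; rewrite ?mulr_ge0 ?divr_ge0 ?ler0n ?harmonic_sum_ge0 ?ler_nat //=.
  by apply: le_trans hq; apply: harmonic_sum_le.
(* [Phi] depends on j only through gcd(j, q), which multiplication by s preserves; hence i = j s mod
   q can be taken as the new variable. *)
have gcdE j : gcdn ((j * s) %% q) q = gcdn j q.
  by rewrite gcdn_modl gcdnC Gauss_gcdl 1?coprime_sym // gcdnC.
have -> : q%:R^-1 * \sum_(1 <= j < q) (2 * q%:R * inv_dist R q ((j * s) %% q)) * (5 * L * Phi j)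
  = 10 * L * \sum_(1 <= i < q) inv_dist R q i * Phi i.
  rewrite -(sum_coprime_shift (fun i => inv_dist R q i * Phi i) q_gt0 cop).
  rewrite !mulr_sumr; apply: eq_bigr => j _.
  have -> : Phi ((j * s) %% q)%N = Phi j by rewrite /Phi gcdE.
  by field; rewrite gt_eqF.
have -> : \sum_(1 <= i < q) inv_dist R q i * Phi i =
    N%:R / q%:R * \sum_(1 <= i < q) inv_dist R q i * (gcdn i q)%:R
    + (Q%:R + q%:R) * \sum_(1 <= i < q) inv_dist R q i.
  rewrite !mulr_sumr -big_split /=; apply: eq_bigr => i _; rewrite /Phi; ring.
have e1 := sum_inv_dist_gcd_le R q_gt0.
have e2 := sum_inv_dist_le R q.
have hq0 := harmonic_sum_ge0 R q.
have t0 : 0 <= (size (divisors q))%:R :> R by rewrite ler0n.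
have e3 : (size (divisors q))%:R * harmonic_sum R q <= L * L by apply: ler_pM.
have e4 : 1 <= L * L by rewrite -[leLHS]mulr1 ler_pM.
have e5 : L <= L * L by apply: ler_peMr.
have Q0 : 0 <= Q%:R :> R by rewrite ler0n.
set S1 := \sum_(_ <= _ < _) _ in e1 *; set S2 := \sum_(_ <= _ < _) _ in e2 *.
have f1 : N%:R / q%:R * S1 <= N%:R / q%:R * (2 * (L * L)) by apply: ler_wpM2l => //; lra.
have f2 : (Q%:R + q%:R) * S2 <= (Q%:R + q%:R) * (2 * (L * L)).
  by apply: ler_wpM2l; lra.
have -> : 20 * L ^+ 3 * (N%:R / q%:R + q%:R + Q%:R) =
    10 * L * (N%:R / q%:R * (2 * (L * L)) + (Q%:R + q%:R) * (2 * (L * L))) by ring.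
by apply: ler_wpM2l; [rewrite mulr_ge0 | apply: lerD].
Qed.

(* The condition q %| a + t is the increment of (a + t) %/ q, so the sum telescopes. *)
Lemma count_residue (R : realType) (q H t : nat) : (0 < q)%N ->
  \sum_(1 <= a < H.+1) (q %| a + t)%N%:R = ((H + t) %/ q)%:R - (t %/ q)%:R :> R.
Proof.
move=> q_gt0; elim: H => [|H IH]; first by rewrite big_geq // add0n subrr.
by rewrite big_nat_recr //= IH addSn divnS // natrD; ring.
Qed.

(** The difference between the count and H/q is a difference of two remainders modulo q, divided by
    q. *)
Lemma residue_discrepancy_le1 (R : realType) (q H t : nat) : (0 < q)%N ->
  `| \sum_(1 <= a < H.+1) (q %| a + t)%N%:R - H%:R / q%:R | <= 1 :> R.
Proof.
move=> q_gt0; rewrite count_residue //.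
have q0 : 0 < q%:R :> R by rewrite ltr0n.
have e1 := divn_eq (H + t) q; have e2 := divn_eq t q.
have m1 : ((H + t) %% q)%:R <= q%:R :> R by rewrite ler_nat ltnW ?ltn_mod.
have m2 : (t %% q)%:R <= q%:R :> R by rewrite ler_nat ltnW ?ltn_mod.
have n1 : 0 <= ((H + t) %% q)%:R :> R by rewrite ler0n.
have n2 : 0 <= (t %% q)%:R :> R by rewrite ler0n.
move/(congr1 (fun x => x%:R : R)): e1; rewrite !natrD natrM.
move/(congr1 (fun x => x%:R : R)): e2; rewrite !natrD natrM.
move: m1 m2 n1 n2; rewrite ler_norml.
move: (((H + t) %/ q)%:R) ((t %/ q)%:R) (((H + t) %% q)%:R) ((t %% q)%:R) (q%:R)
  (t%:R) (H%:R) q0 => x y r1 r2 q' t' H' q0 m1 m2 n1 n2 e2 e1.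
have -> : H' / q' = x - y + (r1 - r2) / q'.
  have -> : H' = (x - y) * q' + (r1 - r2) by lra.
  by field; rewrite gt_eqF.
have : (r1 - r2) / q' <= 1 by rewrite ler_pdivrMr //; lra.
have : -1 <= (r1 - r2) / q' by rewrite ler_pdivlMr //; lra.
by move=> ? ?; apply/andP; split; lra.
Qed.

(** Multiplying by an inverse s' of s modulo q turns the progression a s into consecutive integers,
    with t = s' k. *)
Lemma affine_dvd_shift (q s k : nat) : (0 < q)%N -> coprime s q ->
  exists t, forall a, (q %| k + a * s)%N = (q %| a + t)%N.
Proof.
(* If s = 0, coprimality forces q = 1; this case is separate because the Bézout lemma [egcdnP] wants
   s > 0. *)
move=> q_gt0 cop; case: (posnP s) cop => [->|s_gt0 cop].
  rewrite /coprime gcd0n => /eqP ->; exists 0%N => a; by rewrite !dvd1n.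
have [s' l e _] := egcdnP q s_gt0.
rewrite (eqP cop) in e; exists (s' * k)%N => a.
have cop' : coprime q s'.
  have : coprime q (l * q + 1) by rewrite /coprime gcdnMDl gcdn1.
  by rewrite -e coprimeMr => /andP[].
rewrite -(Gauss_dvdr _ cop') mulnDr (_ : (s' * (a * s))%N = (a * l * q + a)%N).
  by rewrite addnCA dvdn_addr ?dvdn_mull // addnC.
by rewrite mulnCA e mulnDr muln1 mulnA.
Qed.

Lemma discrepancy_trivial (R : realType) (q s c H N d : nat) :
  (0 < q)%N -> coprime s q -> (0 < d)%N ->
  `| \sum_(N.+1 <= n < (2 * N).+1 | (d %| n)%N)
       (\sum_(1 <= a < H.+1) (q %| n + a * s + c)%N%:R - H%:R / q%:R) |
  <= N%:R / d%:R + 1 :> R.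
Proof.
move=> q_gt0 cop d_gt0; apply: (le_trans (ler_norm_sum _ _ _)).
apply: (@le_trans _ _ (\sum_(N.+1 <= n < (2 * N).+1 | (d %| n)%N) 1)).
  apply: ler_sum => n _; have [t ht] := affine_dvd_shift (n + c) q_gt0 cop.
  under eq_bigr do rewrite addnAC ht.
  exact: residue_discrepancy_le1.
rewrite (sum_multiples (fun _ => 1 : R)) ?leq_pmull //.
by rewrite big_const_nat iter_addr_0; apply: count_multiples_le.
Qed.

Lemma discrepancy_sum_trivial (R : realType) (q s c H N Q : nat) :
  (0 < q)%N -> coprime s q ->
  \sum_(1 <= d < Q.+1) `| \sum_(N.+1 <= n < (2 * N).+1 | (d %| n)%N)
       (\sum_(1 <= a < H.+1) (q %| n + a * s + c)%N%:R - H%:R / q%:R) |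
  <= N%:R * harmonic_sum R Q + Q%:R.
Proof.
move=> q_gt0 cop.
apply: (@le_trans _ _ (\sum_(1 <= d < Q.+1) (N%:R / d%:R + 1))).
  rewrite big_nat_cond [leRHS]big_nat_cond; apply: ler_sum => d /andP[/andP[d_gt0 _] _].
  exact: discrepancy_trivial.
by rewrite big_split /= -mulr_sumr big_const_nat iter_addr_0 subn1.
Qed.

(** * Sieve functions in residue classes *)

(** Taking s and c to be the least nonnegative residues of -r and -b moves the whole congruence to
    one side within the natural numbers. *)
Lemma congruence_as_divisibility (q : nat) (r b : int) :
  (0 < q)%N -> coprimez r q%:Z -> exists s c, coprime s q /\
  forall n a : nat, (n%:Z == a%:Z * r + b %[mod q%:Z])%Z = (q %| n + a * s + c)%N.
Proof.
move=> q_gt0 cop; have qz : q%:Z != 0 by rewrite -lt0n.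
exists `|((- r) %% q%:Z)%Z|%N, `|((- b) %% q%:Z)%Z|%N; split.
  have : coprimez ((- r) %% q%:Z)%Z q%:Z.
    by rewrite /coprimez gcdz_modl gcdNz.
  by rewrite coprimezE.
move=> n a; rewrite eqz_mod_dvd.
have -> : (q %| n + a * `|((- r) %% q%:Z)%Z| + `|((- b) %% q%:Z)%Z|)%N
  = (q%:Z %| n%:Z + a%:Z * ((- r) %% q%:Z)%Z + ((- b) %% q%:Z)%Z)%Z.
  by rewrite -{2}(gez0_abs (modz_ge0 (- r) qz)) -{2}(gez0_abs (modz_ge0 (- b) qz)).
have [er eb] := (divz_eq (- r) q%:Z, divz_eq (- b) q%:Z).
have -> : n%:Z - (a%:Z * r + b) = (a%:Z * ((- r) %/ q%:Z)%Z + ((- b) %/ q%:Z)%Z) * q%:Z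
    + (n%:Z + a%:Z * ((- r) %% q%:Z)%Z + ((- b) %% q%:Z)%Z).
  have -> : n%:Z - (a%:Z * r + b) = n%:Z + a%:Z * (- r) + (- b) by ring.
  by rewrite {1}er {1}eb; ring.
by rewrite rpredDl // dvdz_mull.
Qed.

Lemma sieve_discrepancy_expand (R : realType) (K : R -> R) (q H N Q s c : nat)
    (f : nat -> R) : sieve_function K Q f ->
  \sum_(1 <= a < H.+1) \sum_(N.+1 <= n < (2 * N).+1 | (q %| n + a * s + c)%N) f n
  - H%:R / q%:R * \sum_(N.+1 <= n < (2 * N).+1) f n
  = \sum_(1 <= d < Q.+1) eratosthenes f d *
      \sum_(N.+1 <= n < (2 * N).+1 | (d %| n)%N)
       (\sum_(1 <= a < H.+1) (q %| n + a * s + c)%N%:R - H%:R / q%:R).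
Proof.
move=> sf.
have -> : \sum_(1 <= a < H.+1)
    \sum_(N.+1 <= n < (2 * N).+1 | (q %| n + a * s + c)%N) f n =
  \sum_(N.+1 <= n < (2 * N).+1)
    \sum_(1 <= a < H.+1) (q %| n + a * s + c)%N%:R * f n.
  rewrite exchange_big; apply: eq_bigr => a _; rewrite big_mkcond.
  by apply: eq_bigr => n _; case: ifP => _; rewrite ?mul1r ?mul0r.
rewrite mulr_sumr -sumrB.
under [RHS]eq_bigr do rewrite mulr_sumr.
rewrite (exchange_big_dep_nat xpredT) //= big_nat_cond [RHS]big_nat_cond.
apply: eq_bigr => n /andP[/andP[Nn _] _].
rewrite -mulr_suml -mulrBl mulrC {1}(sieve_function_expand sf) ?mulr_suml //.
exact: leq_ltn_trans Nn.
Qed.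

Lemma powR_ge1 (R : realType) (N : nat) (e : R) : (0 < N)%N -> 0 <= e ->
  1 <= N%:R `^ e.
Proof.
move=> N0 e0; have N1 : 1 <= N%:R :> R by rewrite ler1n.
by have := ler_powR N1 e0; rewrite powRr0.
Qed.

Lemma sieve_discrepancy_uniform (R : realType) (K : R -> R) (CQ eps : R) : 0 < eps ->
  exists C : R, forall (q H N Q s c : nat) (f : nat -> R),
    (0 < q)%N -> (0 < N)%N -> (0 < Q)%N -> Q%:R <= CQ * N%:R ->
    sieve_function K Q f -> coprime s q ->
  `| \sum_(1 <= a < H.+1) \sum_(N.+1 <= n < (2 * N).+1 | (q %| n + a * s + c)%N) f n
     - H%:R / q%:R * \sum_(N.+1 <= n < (2 * N).+1) f n |
  <= C * (N%:R `^ eps * (N%:R / q%:R + q%:R + Q%:R)).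
Proof.
(* Four factors N^e occur: one bounds the values g(d), and three come from L^3. *)
move=> eps_gt0; set e := eps / 4.
have e_gt0 : 0 < e by rewrite divr_gt0.
have [Ct ht] := divisor_bound e_gt0.
have [Ch hh] := harmonic_sum_bound e_gt0.
(* The summands of [B] serve 1 <= L, the harmonic sum of q, that of Q (through Q <= A N), and the
   number of divisors of q. Absolute values keep everything nonnegative. *)
set A := `|CQ|; set B := 1 + `|Ch| + `|Ch| * A `^ e + `|Ct|.
exists (`|K e| * A `^ e * 20 * B ^+ 3) => q H N Q s c f q_gt0 N_gt0 Q_gt0 QN sf cop.
have Ae0 : 0 <= A `^ e := powR_ge0 _ _.
have chA0 : 0 <= `|Ch| * A `^ e by rewrite mulr_ge0.
have B_ge1 : 1 <= B by rewrite /B -!addrA lerDl !addr_ge0.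
have Ne1 := powR_ge1 N_gt0 (ltW e_gt0).
set L := B * N%:R `^ e.
have L_ge1 : 1 <= L by rewrite -[leLHS]mulr1 ler_pM.
have scale (x : R) : x <= B -> x * N%:R `^ e <= L.
  by move=> xB; rewrite ler_wpM2r // powR_ge0.
have A0 : 0 <= A := normr_ge0 _.
have QAN : Q%:R <= A * N%:R.
  by apply: (le_trans QN); rewrite ler_wpM2r ?ler0n ?ler_norm.
have QA : Q%:R `^ e <= A `^ e * N%:R `^ e.
  rewrite -powRM ?ler0n //.
  by apply: ge0_ler_powR; rewrite ?nnegrE ?mulr_ge0 ?ler0n // ltW.
have hQ : harmonic_sum R Q <= L.
  apply: (le_trans (hh Q Q_gt0)).
  apply: (@le_trans _ _ (`|Ch| * A `^ e * N%:R `^ e)).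
    rewrite -mulrA; apply: (@le_trans _ _ (`|Ch| * Q%:R `^ e)).
      by rewrite ler_wpM2r ?powR_ge0 ?ler_norm.
    by rewrite ler_wpM2l.
  apply: scale; rewrite /B; have := normr_ge0 Ct; have := normr_ge0 Ch; lra.
have gE d : (1 <= d < Q.+1)%N -> `|eratosthenes f d| <= `|K e| * A `^ e * N%:R `^ e.
  move=> /andP[d_gt0 dQ]; have [_ /(_ e e_gt0 d d_gt0) hg] := sf.
  apply: (le_trans hg); rewrite -mulrA.
  apply: (@le_trans _ _ (`|K e| * d%:R `^ e)).
    by rewrite ler_wpM2r ?powR_ge0 ?ler_norm.
  rewrite ler_wpM2l //; apply: le_trans QA; apply: ge0_ler_powR.
  - exact: ltW.
  - by rewrite nnegrE ler0n.
  - by rewrite nnegrE ler0n.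
  - by rewrite ler_nat -ltnS.
set T := fun d => \sum_(N.+1 <= n < (2 * N).+1 | (d %| n)%N)
       (\sum_(1 <= a < H.+1) (q %| n + a * s + c)%N%:R - H%:R / q%:R) : R.
have q0 : 0 <= q%:R :> R by rewrite ler0n.
have Q0 : 0 <= Q%:R :> R by rewrite ler0n.
have N0 : 0 <= N%:R :> R by rewrite ler0n.
have Nq0 : 0 <= N%:R / q%:R :> R by rewrite divr_ge0.
have TE : \sum_(1 <= d < Q.+1) `|T d| <= 20 * L ^+ 3 * (N%:R / q%:R + q%:R + Q%:R).
  have [qN|Nq] := leqP q N.
    have qNe : q%:R `^ e <= N%:R `^ e.
      by apply: ge0_ler_powR; rewrite ?nnegrE ?ler0n ?ler_nat // ltW.
    apply: discrepancy_sum_le => //.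
      apply: (le_trans (hh q q_gt0)); apply: (@le_trans _ _ (`|Ch| * N%:R `^ e)).
        apply: (@le_trans _ _ (`|Ch| * q%:R `^ e)).
          by rewrite ler_wpM2r ?powR_ge0 ?ler_norm.
        by rewrite ler_wpM2l.
      by apply: scale; rewrite /B; have := normr_ge0 Ct; have := normr_ge0 Ch; lra.
    apply: (le_trans (ht q q_gt0)); apply: (@le_trans _ _ (`|Ct| * N%:R `^ e)).
      apply: (@le_trans _ _ (`|Ct| * q%:R `^ e)).
        by rewrite ler_wpM2r ?powR_ge0 ?ler_norm.
      by rewrite ler_wpM2l.
    by apply: scale; rewrite /B; have := normr_ge0 Ct; have := normr_ge0 Ch; lra.
  (* Here N < q, so N times the harmonic sum of Q is at most q L, which the term q on the right
     absorbs. *)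
  apply: (le_trans (discrepancy_sum_trivial R c H N Q q_gt0 cop)).
  have NqR : N%:R <= q%:R :> R by rewrite ler_nat ltnW.
  have L3 : L <= 20 * L ^+ 3.
    have : 1 <= L ^+ 2 by rewrite exprn_ege1.
    by rewrite exprS => ?; nra.
  apply: (@le_trans _ _ (L * (N%:R / q%:R + q%:R + Q%:R))); last first.
    by rewrite ler_wpM2r ?addr_ge0.
  have : N%:R * harmonic_sum R Q <= q%:R * L.
    by rewrite ler_pM ?harmonic_sum_ge0.
  have : Q%:R <= L * Q%:R by rewrite ler_peMl.
  have : 0 <= L * (N%:R / q%:R) by rewrite mulr_ge0 //; lra.
  by rewrite !mulrDr (mulrC q%:R); lra.
rewrite (sieve_discrepancy_expand q H N s c sf).
apply: (@le_trans _ _ (`|K e| * A `^ e * N%:R `^ e * \sum_(1 <= d < Q.+1) `|T d|)).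
  apply: (le_trans (ler_norm_sum _ _ _)); rewrite mulr_sumr.
  rewrite big_nat_cond [leRHS]big_nat_cond; apply: ler_sum => d /andP[dQ _].
  by rewrite normrM ler_wpM2r // gE.
have -> : N%:R `^ eps = N%:R `^ e ^+ 4.
  by rewrite -powR_mulrn ?powR_ge0 // -powRrM /e divfK.
have -> : `|K e| * A `^ e * 20 * B ^+ 3 *
    (N%:R `^ e ^+ 4 * (N%:R / q%:R + q%:R + Q%:R))
  = `|K e| * A `^ e * N%:R `^ e * (20 * L ^+ 3 * (N%:R / q%:R + q%:R + Q%:R)).
  rewrite /L; move: (N%:R `^ e) (N%:R / q%:R) (A `^ e) => x y z; ring.
by rewrite ler_wpM2l // !mulr_ge0 ?powR_ge0.
Qed.

Theorem mainTheorem1 (R : realType) (K : R -> R) (CQ : R) (eps : R)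
    (eps_gt0 : 0 < eps) :
  exists C : R,
  forall (q H Q : nat -> nat) (f : nat -> nat -> R),
    (forall N : nat, (0 < N)%N -> [/\ (0 < q N)%N, (0 < H N)%N & (0 < Q N)%N]) ->
    (forall N : nat, (0 < N)%N -> (Q N)%:R <= CQ * N%:R) ->
    ((fun N => (H N)%:R : R) =o_ (along q) (fun N => (q N)%:R : R)) ->
    ((fun N => (q N)%:R : R) =o_\oo (fun N => N%:R : R)) ->
    (forall N : nat, (0 < N)%N -> sieve_function K (Q N) (f N)) ->
  forall N : nat, (0 < N)%N ->
  forall r b : int, coprimez r (q N)%:Z ->
    `| \sum_(1 <= a < (H N).+1)
         \sum_(N.+1 <= n < (2 * N).+1
               | (n%:Z == a%:Z * r + b %[mod (q N)%:Z])%Z) f N n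
       - (H N)%:R / (q N)%:R * \sum_(N.+1 <= n < (2 * N).+1) f N n |
    <= C * (N%:R `^ eps * (N%:R / (q N)%:R + (q N)%:R + (Q N)%:R)).
Proof.
have [C hC] := sieve_discrepancy_uniform K CQ eps_gt0.
(* The constant is fixed before [q], [H], [Q], [f], [r] and [b], so the bound is uniform in them and
   can be checked at each N separately. *)
exists C => q H Q f pos QN _ _ sf N N_gt0 r b cop.
have [q_gt0 _ Q_gt0] := pos N N_gt0.
have [s [c [cop_s dvdE]]] := congruence_as_divisibility b q_gt0 cop.
under eq_bigr do under eq_bigl do rewrite dvdE.
exact: hC (QN N N_gt0) (sf N N_gt0) cop_s.
Qed.
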